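(* Let $0<\epsilon<1$ and let $A\subset\mathbb{Z}$ be a finite set with $N=|A|$ and $E(A)\ll |A|^{2+\epsilon}$. Then \[ f_3(A)\gg \frac{\log^{1/4}N}{2^{2\sqrt{(1+\epsilon)\log N}}}\cdot N. \]
   Context: $E(A)$, the additive energy of $A$, is the number of quadruples $(a,b,c,d)\in A^4$ with $a+b=c+d$. For a set $A$, $f_3(A)$ is the size of the largest subset of $A$ containing no non-trivial three-term arithmetic progression $\{x,x+d,x+2d\}$, $d\ne0$. Logarithms are to base 2. *)

(* Defs.v *)
From HB Require Import structures.
From mathcomp Require Import all_boot all_order all_algebra finmap.
From mathcomp Require Import boolp reals exp.

Set Implicit Arguments.
Unset Strict Implicit.
Unset Printing Implicit Defensive.

Import Order.TTheory GRing.Theory Num.Theory.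
Local Open Scope fset_scope.
Local Open Scope ring_scope.

Definition additive_energy (A : {fset int}) : nat :=
  #|` [fset q in (A `*` A) `*` (A `*` A)
      | q.1.1 + q.1.2 == q.2.1 + q.2.2]|.

Definition ap3_free (B : {fset int}) : Prop :=
  forall x d : int, d != 0 -> ~ [/\ x \in B, x + d \in B & x + 2 * d \in B].

Definition f3 (A : {fset int}) : nat :=
  \max_(B <- fpowerset A | `[< ap3_free B >]) #|` B|.

Definition log2 (R : realType) (x : R) : R := ln x / ln 2.

(* Main.v *)
Require Import Defs.
From HB Require Import structures.
From mathcomp Require Import all_boot all_order all_algebra finmap.
From mathcomp Require Import boolp reals exp.
From mathcomp Require Import zify ring lra.

(** Following Green and Wolf, map [A] into [F_p ^ n] by [x |-> x theta + alpha],
    with [theta] and [alpha] random, and keep the elements that land in a thin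
    spherical shell [S] of the box [{0, ..., (p - 1) / 2} ^ n]; then delete one
    term of each surviving progression.  By the parallelogram law the common
    difference of a progression in [S] lies in a small ball, so a progression
    survives with probability at most [|S| / p ^ n] times the density of that
    ball.  The number [T] of progressions in [A] satisfies [T ^ 2 <= |A| E(A)]
    by Cauchy-Schwarz.  As [|x|^2] has standard deviation of order
    [p ^ 2 sqrt n] on the box, pigeonholing gives a shell of density of order
    [2 ^ -n sqrt n N ^ (- (1 + eps) / n)] for which [T] times the density of the
    ball is at most [N / 2], and [n ~ sqrt ((1 + eps) log N)] is optimal. *)

Set Implicit Arguments.
Unset Strict Implicit.
Unset Printing Implicit Defensive.

Import Order.TTheory GRing.Theory Num.Theory.
Local Open Scope fset_scope.
Local Open Scope ring_scope.

(** * Cauchy-Schwarz, and concentration of the squared norm on a box *)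

Lemma sqr_sum_le (I : Type) (s : seq I) (F : I -> nat) :
  ((\sum_(i <- s) F i) ^ 2 <= size s * \sum_(i <- s) F i ^ 2)%N.
Proof.
elim: s => [|i s IHs]; first by rewrite !big_nil.
rewrite !big_cons /=; move: IHs.
set x := F i; set S := (\sum_(j <- s) F j)%N.
set Q := (\sum_(j <- s) F j ^ 2)%N; set n := size s => IHs.
suff H : (2 * (x * S) <= n * x ^ 2 + Q)%N.
  rewrite sqrnD mulSn mulnDr; lia.
have [n0|n_gt0] := posnP n.
  have S0 : S = 0%N by move: n0; rewrite /n /S; case: (s) => // _; rewrite big_nil.
  by rewrite S0 muln0.
rewrite -(leq_pmul2l n_gt0).
apply: leq_trans (_ : (n * x) ^ 2 + S ^ 2 <= _)%N; last by nia.
have := (nat_Cauchy (n * x) S).1; nia.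
Qed.

(** Variance of a sum of independent centred variables: in the expanded square the off-diagonal
    terms vanish and only [#|I|] diagonal ones remain. *)
Lemma sum_sqr_ffun_le (I T : finType) (g : T -> int) (b : int) :
  \sum_t g t = 0 -> (forall t, g t ^+ 2 <= b) ->
  \sum_(f : {ffun I -> T}) (\sum_i g (f i)) ^+ 2 <=
    b *+ (#|I| * #|T| ^ #|I|).
Proof.
move=> g0 gb.
have off (i j : I) : i != j -> \sum_(f : {ffun I -> T}) g (f i) * g (f j) = 0.
  (* Written as a product over all coordinates, the sum over functions factors, and its factor at
     [i] is the sum of [g], which is 0. *)
  move=> nij; pose F l t := (if l == i then g t else 1) *
                            (if l == j then g t else 1).
  transitivity (\sum_(f : {ffun I -> T}) \prod_l F l (f l)).
    apply: eq_bigr => f _; rewrite big_split /=.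
    by rewrite -!big_mkcond /= !big_pred1_eq.
  rewrite -bigA_distr_bigA (bigD1 i) //= [X in X * _](_ : _ = 0) ?mul0r//.
  rewrite -{}[RHS]g0; apply: eq_bigr => t _.
  by rewrite /F eqxx (negPf nij) mulr1.
under eq_bigr do rewrite expr2 big_distrlr /=.
rewrite exchange_big /= mulrnA.
have -> : b *+ #|I| *+ #|T| ^ #|I| = \sum_(i : I) b *+ #|T| ^ #|I|.
  by rewrite sumr_const mulrnAC.
apply: ler_sum => i _; rewrite exchange_big (bigD1 i) //=.
rewrite [X in _ + X]big1 ?addr0; last by move=> j; rewrite eq_sym; exact: off.
rewrite -card_ffun -sumr_const; apply: ler_sum => f _.
by rewrite -expr2.
Qed.

Definition sqnorm n h (f : {ffun 'I_n -> 'I_h}) : nat := \sum_i f i ^ 2.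

Definition shell n h (a W : nat) : {set {ffun 'I_n -> 'I_h}} :=
  [set f | a <= sqnorm f < a + W]%N.

(* Chebyshev's inequality, as [sqnorm] has variance at most [n * h ^ 4]. *)
Lemma sqnorm_concentration n h s : (0 < h)%N -> (0 < s)%N -> (n <= s ^ 2)%N ->
  exists a, (3 * h ^ n <=
    4 * #|[set f : {ffun 'I_n -> 'I_h} | a <= sqnorm f < a + 4 * s * h ^ 2]|)%N.
Proof.
move=> h0 s0 ns.
pose Q : int := (\sum_(k < h) k ^ 2)%N.
(* [h] times the deviation of [k ^ 2] from its mean [Q / h], which keeps the computation in the
   integers. *)
pose g (k : 'I_h) : int := h%:Z * (k ^ 2)%N%:Z - Q.
have Qb : 0 <= Q <= (h ^ 3)%N%:Z.
  rewrite /Q; apply/andP; split; first by lia.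
  rewrite lez_nat expnS.
  have -> : (h * h ^ 2 = \sum_(k < h) h ^ 2)%N by rewrite sum_nat_const card_ord.
  by apply: leq_sum => k _; rewrite leq_sqr ltnW.
have g0 : \sum_k g k = 0.
  rewrite /g big_split /= sumr_const card_ord -mulr_sumr.
  rewrite -(big_morph Posz PoszD (erefl _)) /= -/Q.
  by rewrite mulNrn -mulr_natl natz subrr.
have gb k : g k ^+ 2 <= (h ^ 6)%N%:Z.
  have : - (h ^ 3)%N%:Z <= g k <= (h ^ 3)%N%:Z.
    have : (h * k ^ 2 <= h ^ 3)%N.
      by rewrite (expnS h 2) leq_mul2l leq_sqr (ltnW (ltn_ord k)) orbT.
    by rewrite /g; lia.
  have -> : (h ^ 6 = (h ^ 3) ^ 2)%N by rewrite -expnM.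
  by rewrite -!mulnn expr2; nia.
have gsum (f : {ffun 'I_n -> 'I_h}) :
    \sum_i g (f i) = h%:Z * (sqnorm f)%:Z - Q *+ n.
  rewrite /g big_split /= sumr_const card_ord mulNrn -mulr_sumr.
  by rewrite -(big_morph Posz PoszD (erefl _)).
(* [D ^ 2 = 4 * s ^ 2 * h ^ 6] is at least four times the variance bound [n * h ^ 6], so at most a
   quarter of the box is bad. *)
pose D := (2 * s * h ^ 3)%N.
pose good := [set f : {ffun 'I_n -> 'I_h} | `|\sum_i g (f i)| < D%:Z].
have cardbad : (4 * #|~: good| <= h ^ n)%N.
  have := sum_sqr_ffun_le 'I_n g0 gb; rewrite !card_ord => le1.
  have : \sum_(f in ~: good) (D ^ 2)%N%:Z <=
         \sum_(f : {ffun 'I_n -> 'I_h}) (\sum_i g (f i)) ^+ 2.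
    rewrite [leRHS](bigID (mem (~: good))) /=.
    rewrite -[leLHS]addr0 lerD //; last by apply: sumr_ge0 => f _; exact: sqr_ge0.
    apply: ler_sum => f; rewrite !inE -leNgt => le2.
    by rewrite -[leRHS]real_normK ?num_real// -mulnn PoszM expr2 ler_pM.
  move=> /le_trans /(_ le1); rewrite sumr_const.
  have mulrnZ (x : int) k : x *+ k = x * k%:Z by rewrite -mulr_natr natz.
  rewrite !mulrnZ -!PoszM lez_nat.
  rewrite /D => le3.
  have h6 : (0 < h ^ 6 * s ^ 2)%N by rewrite muln_gt0 !expn_gt0 h0 s0.
  rewrite -(leq_pmul2l h6).
  have -> : (h ^ 6 * s ^ 2 * (4 * #|~: good|) = (2 * s * h ^ 3) ^ 2 * #|~: good|)%N.
    by rewrite (expnMn (2 * s)) (expnMn 2) -expnM; lia.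
  apply: leq_trans le3 _.
  rewrite -mulnA leq_mul2l leq_mul2r ns orbT orbT //.
have cardgood : (3 * h ^ n <= 4 * #|good|)%N.
  by have := cardsC good; rewrite card_ffun !card_ord; lia.
have /card_gt0P[f0 f0good] : (0 < #|good|)%N.
  by have : (0 < h ^ n)%N; [rewrite expn_gt0 h0 | lia].
(* The window starts at the least squared norm of a good point: two good points have squared norms
   less than [2 * D / h = 4 * s * h ^ 2] apart. *)
have [f1 f1good f1min] := arg_minnP (@sqnorm n h) f0good.
exists (sqnorm f1); apply: leq_trans cardgood _.
rewrite leq_mul2l; apply/orP; right; apply/subset_leq_card/subsetP => f fgood.
rewrite inE f1min //=.
move: (f1good : f1 \in good) fgood; rewrite !inE !gsum !ltr_norml.
move=> /andP[l1 _] /andP[_ l2].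
have : h%:Z * (sqnorm f)%:Z - h%:Z * (sqnorm f1)%:Z < D%:Z + D%:Z.
  by move: l1 l2; move: (h%:Z * _) (h%:Z * _) (Q *+ n) (D%:Z); clear; lia.
rewrite -mulrBr /D expnS => l3.
have h0' : 0 < h%:Z by rewrite ltz_nat.
have : h%:Z * ((sqnorm f)%:Z - (sqnorm f1)%:Z) < h%:Z * (4 * s * h ^ 2)%N%:Z.
  by apply: lt_le_trans l3 _; lia.
by rewrite ltr_pM2l //; lia.
Qed.

(** Pigeonhole: consecutive shells of width [W] cover the concentration window, and the most
    populated one is taken. *)
Lemma shell_large n h s W : (0 < h)%N -> (0 < s)%N -> (0 < W)%N ->
  (n <= s ^ 2)%N ->
  exists a, (3 * h ^ n <= 4 * ((4 * s * h ^ 2) %/ W).+1 * #|shell n h a W|)%N.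
Proof.
move=> h0 s0 W0 ns; have [a0 le_a0] := sqnorm_concentration h0 s0 ns.
set L := (4 * s * h ^ 2 %/ W)%N in le_a0 *.
pose N j := #|shell n h (a0 + j * W) W|.
have [j _ jmax] := arg_maxnP (fun j : 'I_L.+1 => N j) (erefl : xpredT ord0).
exists (a0 + j * W)%N; apply: leq_trans le_a0 _.
rewrite -[leqRHS]mulnA leq_mul2l /=.
apply: leq_trans (_ : \sum_(k < L.+1) N k <= _)%N; last first.
  rewrite -[X in (_ <= X * _)%N]card_ord -sum_nat_const.
  by apply: leq_sum => k _; exact: jmax.
apply: leq_trans (_ : #|\bigcup_(k < L.+1) shell n h (a0 + k * W) W| <= _)%N.
  apply/subset_leq_card/subsetP => f; rewrite inE => /andP[af fa].
  have kL : ((sqnorm f - a0) %/ W < L.+1)%N.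
    by rewrite ltnS leq_div2r //; lia.
  apply/bigcupP; exists (Ordinal kL) => //; rewrite inE /=.
  have := leq_trunc_div (sqnorm f - a0) W.
  have := ltn_ceil (sqnorm f - a0) W0; rewrite mulSn; lia.
elim/big_ind2: _ => [|A a B b leA leB|//]; first by rewrite cards0.
by rewrite (leq_trans (leq_card_setU _ _)) // leq_add.
Qed.

(** * Counting lattice points in a ball *)

Lemma ffact_le_exp n m : (n ^_ m <= n ^ m)%N.
Proof.
rewrite ffact_prod -[X in (_ <= _ ^ X)%N]card_ord -prod_nat_const.
by apply: leq_prod => i _; rewrite leq_subr.
Qed.

Lemma exp_le_ffactD n m : (n ^ m <= (n + m) ^_ m)%N.
Proof.
rewrite ffact_prod -[X in (_ ^ X <= _)%N]card_ord -prod_nat_const.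
by apply: leq_prod => i _; have := ltn_ord i; lia.
Qed.

Lemma bin_le_exp2 n m : ('C(n, m) <= 2 ^ n)%N.
Proof.
have [lt|le] := ltnP n m; first by rewrite bin_small.
rewrite -[2%N]/(1 + 1)%N expnDn.
have le' : (m < n.+1)%N by [].
by rewrite (bigD1 (Ordinal le')) //= !exp1n !muln1 leq_addr.
Qed.

(* Compare both sides with ['C(2n, n) * n!]. *)
Lemma expnn_le_fact n : (n ^ n <= 4 ^ n * n`!)%N.
Proof.
apply: leq_trans (exp_le_ffactD n n) _; rewrite -bin_ffact leq_mul2r.
apply/orP; right; apply: leq_trans (bin_le_exp2 _ _) _.
by rewrite addnn -mul2n expnM.
Qed.

(** This binomial coefficient counts the [n]-tuples of naturals with sum at most [n * k]. *)
Lemma bin_mul_le n k : ('C(n + n * k, n) <= (4 * k.+1) ^ n)%N.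
Proof.
rewrite -(leq_pmul2r (fact_gt0 n)) bin_ffact.
apply: leq_trans (ffact_le_exp _ _) _.
rewrite -mulnS !expnMn -mulnA [X in (_ <= _ * X)%N]mulnC mulnA leq_mul2r.
by rewrite expnn_le_fact orbT.
Qed.

(* The [l2] ball of radius [K * sqrt n] lies in the [l1] ball of radius
   [n * K]. *)
Lemma card_ball_le n h K (g : {ffun 'I_n -> 'I_h}) : (0 < K)%N ->
  (#|[set f : {ffun 'I_n -> 'I_h} | \sum_i `|f i - g i| ^ 2 <= n * K ^ 2]|
     <= (16 * K) ^ n)%N.
Proof.
move=> K0; set B := [set f | _].
(* A point is determined by the signs and the sizes of its coordinate differences from [g]; there
   are [2 ^ n] sign patterns. *)
pose enc (f : {ffun 'I_n -> 'I_h}) : {ffun 'I_n -> bool} * n.-tuple 'I_(n * K).+1 :=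
  ([ffun i => (f i <= g i)%N], [tuple inord `|f i - g i|%N | i < n]).
pose P := [set t : n.-tuple 'I_(n * K).+1 | \sum_(i <- t) i <= n * K]%N.
have l1 f : f \in B -> (\sum_i `|f i - g i| <= n * K)%N.
  rewrite inE => fB; rewrite -(leq_pmul2l (_ : 0 < 2 * K)%N) ?muln_gt0 ?K0//.
  rewrite big_distrr /=.
  apply: leq_trans (_ : \sum_(i < n) (`|f i - g i| ^ 2 + K ^ 2) <= _)%N.
    apply: leq_sum => i _; move: `|f i - g i|%N => y.
    by have := (nat_Cauchy K y).1; rewrite mulnA addnC.
  rewrite big_split /= sum_nat_const card_ord.
  have -> : (2 * K * (n * K) = n * K ^ 2 + n * K ^ 2)%N by rewrite -mulnn; lia.
  by rewrite leq_add2r.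
have l1i f i : f \in B -> (`|f i - g i| <= n * K)%N.
  by move/l1; apply: leq_trans; rewrite (bigD1 i) //= leq_addr.
have enc_inj : {in B &, injective enc}.
  move=> f1 f2 B1 B2 e; apply/ffunP => i; apply/val_inj => /=.
  have /ffunP/(_ i) := congr1 fst e; rewrite !ffunE.
  have /(congr1 (fun t => tnth t i)) := congr1 snd e.
  rewrite !tnth_mktuple => /(congr1 val); rewrite /= !inordK ?ltnS ?l1i //.
  lia.
rewrite -(card_in_imset enc_inj).
apply: leq_trans (_ : #|setX [set: {ffun 'I_n -> bool}] P| <= _)%N.
  apply/subset_leq_card/subsetP => _ /imsetP[f fB ->].
  rewrite !inE /= big_map big_enum /=.
  under eq_bigr => i _ do rewrite inordK ?ltnS ?l1i //.
  exact: l1.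
rewrite cardsX cardsT card_ffun card_bool card_ord /P card_partial_ord_partitions.
apply: leq_trans (leq_mul (leqnn _) (bin_mul_le _ _)) _.
by rewrite -expnMn; case: (n) => // k; rewrite leq_exp2r; lia.
Qed.

(** * Progressions and additive energy *)

(** Here [x] is an end term and [y] the middle one, so each progression is counted twice, once per
    direction. *)
Definition ap3_pairs (A : {fset int}) : nat :=
  \sum_(x <- A) \sum_(y <- A) ((x != y) && (y *+ 2 - x \in A)%R)%N.

Lemma big_fsetM (S T : choiceType) (A : {fset S}) (B : {fset T})
    (F : S * T -> nat) :
  (\sum_(q <- A `*` B) F q = \sum_(a <- A) \sum_(b <- B) F (a, b))%N.
Proof.
rewrite -big_allpairs.
apply: perm_big; apply: uniq_perm; rewrite ?fset_uniq //.
  by apply: allpairs_uniq; rewrite ?fset_uniq // => -[? ?] [? ?].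
move=> [a b]; rewrite in_fsetM /=.
apply/andP/allpairsP => [[aA bB]|[[a' b'] /= [aA bB [-> ->]]]] //.
by exists (a, b).
Qed.

Lemma card_fset_filter (T : choiceType) (A : {fset T}) (P : pred T) :
  #|` [fset q in A | P q]| = (\sum_(q <- A) P q)%N.
Proof.
rewrite -big_mkcond sum1_count -size_filter.
apply: perm_size; apply: uniq_perm; rewrite ?filter_uniq ?fset_uniq //.
by move=> q; rewrite mem_filter !inE andbC.
Qed.

Lemma sum_nat_eq_uniq (T : choiceType) (A : {fset T}) (x : T) :
  (\sum_(a <- A) (a == x) = (x \in A))%N.
Proof.
rewrite -big_mkcond /= sum1_count -(count_uniq_mem x (fset_uniq A)).
exact: eq_count.
Qed.

(** Cauchy-Schwarz over the middle term [y]: two representations of [2y] as a sum in [A] form an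
    energy quadruple, and this quadruple determines [y]. *)
Lemma ap3_pairs_energy (A : {fset int}) :
  (ap3_pairs A ^ 2 <= #|` A| * additive_energy A)%N.
Proof.
pose r y := (\sum_(q <- A `*` A) (q.1 + q.2 == y *+ 2)%R)%N.
have le_r : (ap3_pairs A <= \sum_(y <- A) r y)%N.
  rewrite /ap3_pairs exchange_big /=; apply: leq_sum => y _.
  rewrite /r big_fsetM; apply: leq_sum => x _; case: eqVneq => //= _.
  rewrite -sum_nat_eq_uniq; apply: leq_sum => z _.
  by rewrite eq_sym subr_eq addrC eq_sym.
apply: leq_trans (_ : (\sum_(y <- A) r y) ^ 2 <= _)%N; first by rewrite leq_sqr.
apply: leq_trans (sqr_sum_le _ _) _; rewrite leq_mul2l; apply/orP; right.
rewrite /additive_energy card_fset_filter big_fsetM.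
under eq_bigr => y _ do rewrite -mulnn big_distrlr /=.
rewrite exchange_big /=; apply: leq_sum => q _.
rewrite exchange_big /=; apply: leq_sum => q' _.
case: eqP => [->|neq]; last first.
  by rewrite big1_seq // => y _; do 2!case: eqP => //; congruence.
apply: leq_trans (_ : \sum_(y <- A) (y *+ 2 == q'.1 + q'.2)%R <= _)%N.
  by apply: leq_sum => y _; rewrite eq_sym; case: eqP.
have [[y /eqP yq]|no] := pselect (exists y : int, y *+ 2 == q'.1 + q'.2).
  apply: leq_trans (_ : \sum_(z <- A) (z == y)%R <= _)%N.
    apply: leq_sum => z _; rewrite -yq; case: eqP => // e; suff -> : z == y by [].
    by apply/eqP; lia.
  by rewrite sum_nat_eq_uniq; case: (_ \in _).
rewrite big1_seq // => y _; case: eqP => // e.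
by case: no; exists y; apply/eqP.
Qed.

Lemma card_le_f3 (A B : {fset int}) : B `<=` A -> ap3_free B -> (#|` B| <= f3 A)%N.
Proof.
move=> BA Bfree; rewrite /f3.
by apply: (@leq_bigmax_seq _ _ _ (fun X : {fset int} => #|` X|)) => //;
  [rewrite fpowersetE | apply/asboolP].
Qed.

(* Deleting the first term of every progression. *)
Lemma f3_ge_deletion (A B : {fset int}) : B `<=` A ->
  (#|` B| <= f3 A + ap3_pairs B)%N.
Proof.
move=> BA.
pose P x := has (fun y => (x != y) && (y *+ 2 - x \in B)) B.
pose B' := [fset x in B | ~~ P x].
have B'f3 : (#|` B'| <= f3 A)%N.
  apply: card_le_f3; first by apply: fsubset_trans BA; exact: fset_sub.
  move=> x d d0 []; rewrite !inE /= => /andP[xB /negP nPx] /andP[xdB _] /andP[x2dB _].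
  apply: nPx; apply/hasP; exists (x + d) => //.
  have -> : (x + d) *+ 2 - x = x + 2 * d by ring.
  rewrite x2dB andbT; lia.
apply: leq_trans (leq_add B'f3 (leqnn _)).
rewrite card_fset_filter -[X in (X <= _)%N]sum1_size /ap3_pairs -big_split /=.
apply: leq_sum => x _; case: (boolP (P x)) => //= /hasP[y yB Py].
by rewrite (big_rem y) //= Py.
Qed.

(** * Averaging over affine maps into [F_p ^ n] *)

(** Pairs with equal components have to be counted: distinct integers share their image when
    [theta = 0]. *)
Definition mid3 (p n : nat) (S : {set 'rV['F_p]_n}) : nat :=
  #|[set q : 'rV['F_p]_n * 'rV['F_p]_n |
     [&& q.1 \in S, q.2 \in S & q.2 *+ 2 - q.1 \in S]]|.

(* Averaging over the maps [x |-> x * theta + alpha]. *)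
Lemma f3_ge_average (A : {fset int}) p n (S : {set 'rV['F_p]_n}) : prime p ->
  {in A &, forall x y, x != y -> ~~ (p %| x - y)%Z} ->
  (#|` A| * (p ^ n * #|S|) <= f3 A * p ^ (n + n) + ap3_pairs A * mid3 S)%N.
Proof.
move=> pr_p Ap; pose V := 'rV['F_p]_n.
have cardV : #|{: V}| = (p ^ n)%N by rewrite card_mx card_Fp // mul1n.
pose phi (w : V * V) (x : int) : V := x%:~R *: w.1 + w.2.
pose lift w := [fset x in A | phi w x \in S].
have cardlift : (\sum_w #|` lift w| = #|` A| * (p ^ n * #|S|))%N.
  under eq_bigr do rewrite card_fset_filter.
  rewrite exchange_big /= (eq_bigr (fun=> p ^ n * #|S|)%N).
    by rewrite big_const_seq iter_addn_0 count_predT mulnC.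
  move=> x _; rewrite -(pair_bigA _ (fun t a => nat_of_bool (phi (t, a) x \in S))) /=.
  rewrite (eq_bigr (fun=> #|S|)) ?sum_nat_const ?cardV // => t _.
  (* For fixed [t], the image of [x] is a translate of the uniform [a], so it hits [S] for exactly
     [#|S|] values of [a]. *)
  rewrite (reindex_inj (addrI (- (x%:~R *: t)))) /= -big_mkcond /= -sum1_card.
  by apply: eq_bigl => a; rewrite /phi /= addrA subrr add0r.
have pairs_lift : (\sum_w ap3_pairs (lift w) <= ap3_pairs A * mid3 S)%N.
  apply: leq_trans (_ : \sum_w \sum_(x <- A) \sum_(y <- A)
     ([&& x != y, y *+ 2 - x \in A & [&& phi w x \in S, phi w y \in S &
        phi w y *+ 2 - phi w x \in S]])%R <= _)%N.
    apply: leq_sum => w _; rewrite /ap3_pairs.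
    rewrite -big_fset_condE big_mkcond; apply: leq_sum => x _.
    case: ifP => // Sx; rewrite -big_fset_condE big_mkcond; apply: leq_sum => y _.
    case: ifP => // Sy; case: eqP => //= _; rewrite !inE /=.
    suff -> : phi w (y *+ 2 - x) = phi w y *+ 2 - phi w x by [].
    rewrite /phi rmorphB rmorphMn /= scalerBl mulrnDl scalerMnl.
    by rewrite opprD addrACA [w.2 *+ 2]mulr2n addrK.
  rewrite exchange_big /= /ap3_pairs big_distrl /=.
  rewrite big_seq [leqRHS]big_seq; apply: leq_sum => x xA.
  rewrite exchange_big /= big_distrl /=.
  rewrite big_seq [leqRHS]big_seq; apply: leq_sum => y yA.
  case: (eqVneq x y) => [|nxy]; first by rewrite sum_nat_const muln0.
  case: (y *+ 2 - x \in A) => /=; last by rewrite sum_nat_const muln0.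
  rewrite mul1n -big_mkcond sum1dep_card /mid3.
  pose psi w := (phi w x, phi w y).
  (* As [x - y] is invertible modulo [p], the two images determine [theta] and then [alpha]: they
     are jointly uniform. *)
  have psi_inj : injective psi.
    move=> [t a] [t' a'] [e1 e2].
    have /eqP : (x - y)%:~R *: t = (x - y)%:~R *: t' :> V.
      rewrite rmorphB /= !scalerBl.
      have : phi (t, a) x - phi (t, a) y = phi (t', a') x - phi (t', a') y.
        by rewrite e1 e2.
      by rewrite /phi /= !opprD (addrACA _ a) (addrACA _ a') !subrr !addr0.
    have nz : (x - y)%:~R != 0 :> 'F_p.
      by rewrite -(dvdz_pcharf (pchar_Fp pr_p)) Ap.
    rewrite -subr_eq0 -scalerBr scaler_eq0 (negPf nz) /= subr_eq0 => /eqP tt'.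
    by move: e1; rewrite /phi /= tt' => /addrI ->.
  rewrite -(card_imset _ psi_inj); apply/subset_leq_card/subsetP.
  by move=> _ /imsetP[w + ->]; rewrite !inE.
rewrite -cardlift.
apply: leq_trans (leq_add (leqnn _) pairs_lift).
have -> : (f3 A * p ^ (n + n) = \sum_(w : V * V) f3 A)%N.
  by rewrite sum_nat_const card_prod cardV expnD mulnC.
rewrite -big_split /=; apply: leq_sum => w _.
by apply: f3_ge_deletion; exact: fset_sub.
Qed.

(** * Progressions in a shell of the box *)

Definition box_row p n h (f : {ffun 'I_n -> 'I_h}) : 'rV['F_p]_n :=
  \row_i (f i)%:R.

Lemma box_row_inj p n h : prime p -> (h <= p)%N -> injective (@box_row p n h).
Proof.
move=> pr_p hp f g /rowP fg; apply/ffunP => i; apply/val_inj.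
have := congr1 val (fg i); rewrite !mxE /= !val_Fp_nat //.
by rewrite !modn_small // (leq_trans (ltn_ord _)).
Qed.

(* No wrap-around: in a box of side at most [(p + 1) / 2] a progression modulo
   [p] is a progression of integers. *)
Lemma box_row_mid p n h (f g e : {ffun 'I_n -> 'I_h}) i : prime p ->
  (h.*2 <= p.+1)%N -> box_row p g *+ 2 - box_row p f = box_row p e ->
  (f i + e i = (g i).*2)%N.
Proof.
move=> pr_p hp /eqP; rewrite subr_eq => /eqP/rowP/(_ i).
rewrite !mulr2n !mxE -!natrD => /(congr1 val); rewrite /= !val_Fp_nat //.
have := (ltn_ord (f i), ltn_ord (g i), ltn_ord (e i)) => -[[fi gi] ei].
by rewrite !modn_small; lia.
Qed.

Lemma parallelogram_nat (x y z : nat) : (x + z = y.*2)%N ->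
  (x ^ 2 + z ^ 2 = 2 * y ^ 2 + 2 * `|x - y| ^ 2)%N.
Proof.
move=> xyz; rewrite -!mulnn; case: (leqP x y) => xy.
  have [d yE] : exists d, y = (x + d)%N by exists (y - x)%N; lia.
  have -> : z = (x + d + d)%N by lia.
  have -> : `|x - y|%N = d by lia.
  by rewrite yE; lia.
have [d xE] : exists d, x = (y + d)%N by exists (x - y)%N; lia.
have -> : y = (z + d)%N by lia.
have -> : x = (z + d + d)%N by lia.
have -> : `|(z + d + d)%N - (z + d)%N|%N = d by lia.
by lia.
Qed.

(* The parallelogram law makes the common difference of a progression in a shell
   of width [n * K ^ 2] have squared norm at most [n * K ^ 2]. *)
Lemma mid3_shell p n h a K : prime p -> (h.*2 <= p.+1)%N -> (0 < K)%N ->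
  (mid3 [set box_row p f | f in shell n h a (n * K ^ 2)]
     <= #|shell n h a (n * K ^ 2)| * (16 * K) ^ n)%N.
Proof.
move=> pr_p hp K0; set S := shell _ _ _ _.
pose ball (g : {ffun 'I_n -> 'I_h}) := [set f : {ffun 'I_n -> 'I_h} |
  (\sum_i `|f i - g i| ^ 2 <= n * K ^ 2)%N].
(* The middle term comes first here, as the ball is centred at it; [enc] restores the order used in
   [mid3]. *)
pose Q := [set q : {ffun 'I_n -> 'I_h} * {ffun 'I_n -> 'I_h} |
  (q.1 \in S) && (q.2 \in ball q.1)].
apply: (@leq_trans #|Q|); last first.
  rewrite -sum1dep_card.
  rewrite -(pair_big_dep (mem S) (fun g f => f \in ball g) (fun _ _ => 1%N)) /=.
  rewrite -sum_nat_const; apply: leq_sum => g _.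
  by rewrite sum1_card card_ball_le.
pose enc (q : {ffun 'I_n -> 'I_h} * {ffun 'I_n -> 'I_h}) :=
  (box_row p q.2, box_row p q.1).
apply: leq_trans (leq_imset_card enc Q); apply/subset_leq_card/subsetP => q.
rewrite inE => /and3P[/imsetP[f fS q1] /imsetP[g gS q2] /imsetP[e eS]].
rewrite q1 q2 => fge; apply/imsetP; exists (g, f); last first.
  by rewrite /enc /= -q1 -q2; case: (q).
rewrite !inE; apply/andP; split; first by move: gS; rewrite inE.
have par : (sqnorm f + sqnorm e =
            (sqnorm g).*2 + (\sum_i `|f i - g i| ^ 2).*2)%N.
  rewrite /sqnorm -!mul2n !big_distrr /= -!big_split /=; apply: eq_bigr => i _.
  exact/parallelogram_nat/(box_row_mid i pr_p hp fge).
move: fS gS eS par; rewrite !inE /=; lia.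
Qed.

(** * Choice of the prime, the box and the shell *)

(** The ball is made to have density at most [m ^ -n], so the hypothesis on [ap3_pairs A] lets
    progressions cost at most half of the expected surviving points. *)
Lemma f3_ge_of_ap3_pairs (A : {fset int}) n m s : (0 < n)%N -> (0 < m)%N ->
  (n <= s ^ 2)%N -> (n <= m ^ 4)%N -> (2 * ap3_pairs A <= m ^ n * #|` A|)%N ->
  (n * #|` A| <= 2 ^ 14 * s * m ^ 2 * (f3 A * 2 ^ n))%N.
Proof.
move=> n0 m0 ns nm Tle.
have s0 : (0 < s)%N by move: ns; case: (s) => //; lia.
(* [p] exceeds every difference in [A], so it divides no nonzero one; it is also odd and larger than
   [16 * m], which makes [K] positive. *)
have [p p_big pr_p] :=
  prime_above (16 * m + 2 + \sum_(x <- A) \sum_(y <- A) `|x - y|)%N.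
have Ap : {in A &, forall x y, x != y -> ~~ (p %| x - y)%Z}.
  move=> x y xA yA nxy; apply/negP; rewrite dvdzE /= => /dvdn_leq le_p.
  have : (p <= `|x - y|)%N by apply: le_p; lia.
  suff : (`|x - y| <= \sum_(x <- A) \sum_(y <- A) `|x - y|)%N by lia.
  by rewrite (big_rem x) //= (big_rem y) //=; lia.
have p2 : odd p by case: (even_prime pr_p) => // p2; lia.
(* [(p + 1) / 2] is the largest side allowed by the no-wrap-around condition. *)
pose h := (p./2).+1; have hp : h.*2 = p.+1 by rewrite /h; lia.
pose K := (p %/ (16 * m))%N.
have K_le : (K * (16 * m) <= p)%N := leq_trunc_div p (16 * m).
have K_ge : (p < K.+1 * (16 * m))%N by apply: ltn_ceil; lia.
have K0 : (0 < K)%N by rewrite divn_gt0; lia.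
have hK : (h <= 32 * m * K)%N by have := leq_pmulr m K0; lia.
have nK0 : (0 < n * K ^ 2)%N by rewrite muln_gt0 n0 expn_gt0 K0.
have [a] := shell_large (erefl : 0 < h)%N s0 nK0 ns.
set L := (_ %/ (n * K ^ 2))%N; set S := shell _ _ _ _ => Sbig.
have LW : (L * (n * K ^ 2) <= 4 * s * h ^ 2)%N := leq_trunc_div _ _.
have cS : #|[set box_row p f | f in S]| = #|S|.
  by apply: card_imset; apply: box_row_inj => //; lia.
have := f3_ge_average [set box_row p f | f in S] pr_p Ap; rewrite cS => avg.
have mid : (mid3 [set box_row p f | f in S] <= #|S| * (16 * K) ^ n)%N.
  by apply: mid3_shell => //; rewrite hp.
have NS : (#|` A| * #|S| <= 2 * f3 A * p ^ n)%N.
  have pn0 : (0 < p ^ n)%N by rewrite expn_gt0 prime_gt0.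
  rewrite -(leq_pmul2l pn0).
  have le1 : (2 * ap3_pairs A * (16 * K) ^ n <= #|` A| * p ^ n)%N.
    apply: leq_trans (_ : m ^ n * #|` A| * (16 * K) ^ n <= _)%N.
      by rewrite leq_mul2r Tle orbT.
    rewrite mulnAC -expnMn mulnC leq_mul2l leq_exp2r // orbC.
    by apply/orP; left; lia.
  have le2 : (2 * (ap3_pairs A * mid3 [set box_row p f | f in S]) <=
              #|` A| * p ^ n * #|S|)%N.
    apply: leq_trans (_ : 2 * (ap3_pairs A * (#|S| * (16 * K) ^ n)) <= _)%N.
      by rewrite !leq_mul2l mid !orbT.
    apply: leq_trans (leq_mul le1 (leqnn #|S|)); lia.
  move: avg le2; rewrite expnD; lia.
have main : (3 * #|` A| <= 8 * L.+1 * (f3 A * 2 ^ n))%N.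
  have hn0 : (0 < h ^ n)%N by rewrite expn_gt0.
  rewrite -(leq_pmul2l hn0).
  (* The loss [2 ^ n] enters here, through the density of the box in [F_p ^ n]. *)
  have pn : (p ^ n <= 2 ^ n * h ^ n)%N by rewrite -expnMn leq_exp2r //; lia.
  apply: leq_trans (_ : 4 * L.+1 * #|S| * #|` A| <= _)%N.
    apply: leq_trans (leq_mul Sbig (leqnn #|` A|)); lia.
  apply: leq_trans (_ : 4 * L.+1 * (2 * f3 A * p ^ n) <= _)%N.
    by rewrite -mulnA [(#|S| * _)%N]mulnC leq_mul2l NS orbT.
  apply: leq_trans (_ : 4 * L.+1 * (2 * f3 A * (2 ^ n * h ^ n)) <= _)%N.
    by rewrite !leq_mul2l pn !orbT.
  by move: (2 ^ n)%N (h ^ n)%N => u v; lia.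
have nL : (n * L <= 4 * 32 ^ 2 * (s * m ^ 2))%N.
  have K20 : (0 < K ^ 2)%N by rewrite expn_gt0 K0.
  rewrite -(leq_pmul2l K20).
  apply: leq_trans (_ : 4 * s * h ^ 2 <= _)%N; first by move: LW; lia.
  move: hK; rewrite -leq_sqr (expnMn (32 * m)) (expnMn 32) => hK.
  apply: leq_trans (leq_mul (leqnn (4 * s)) hK) _.
  by move: (32 ^ 2)%N (m ^ 2)%N (K ^ 2)%N => u v w; lia.
(* This absorbs the extra shell in [L.+1]. *)
have n_le : (n <= s * m ^ 2)%N.
  by rewrite -leq_sqr expnMn -expnM -mulnn leq_mul.
rewrite -[(2 ^ 14 * s * _)%N]mulnA.
move: main nL n_le; move: (s * m ^ 2)%N (f3 A * 2 ^ n)%N #|` A| => u v N; clear.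
move=> main nL n_le.
have le1 : (n * L.+1 * v <= (4 * 32 ^ 2 + 1) * u * v)%N.
  by rewrite leq_mul2r mulnS mulnDl mul1n addnC leq_add ?orbT.
have le2 : (8 * (4 * 32 ^ 2 + 1) <= 3 * 2 ^ 14)%N by lia.
move: le1 le2; move: (4 * 32 ^ 2 + 1)%N (2 ^ 14)%N => k c le1 le2.
have le3 := leq_mul le2 (leqnn (u * v)).
by have := leq_mul (leqnn n) main; move: L.+1 le1 => j le1; lia.
Qed.

(** * Optimising the dimension *)

Lemma powR_log2 (R : realType) (x : R) : 0 < x -> 2 `^ log2 x = x.
Proof.
move=> x0; have ln2 : ln 2 != 0 :> R by rewrite gt_eqF // ln_gt0 // ltr1n.
by rewrite /powR /log2 pnatr_eq0 /= divfK // lnK.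
Qed.

Lemma nat_above (R : realType) (x : R) : 0 <= x ->
  exists k : nat, x < k.+1%:R /\ k%:R <= x.
Proof. by move=> /truncn_itv/andP[le lt]; exists (Num.truncn x). Qed.

Theorem theorem6p6 (R : realType) (C : R) (C_gt0 : 0 < C) :
  exists2 c : R, 0 < c &
    forall (eps : R) (A : {fset int}),
      0 < eps < 1 ->
      (additive_energy A)%:R <= C * (#|` A|%:R `^ (2 + eps)) ->
      c * (log2 #|` A|%:R `^ (1 / 4)
           / 2 `^ (2 * Num.sqrt ((1 + eps) * log2 #|` A|%:R)) * #|` A|%:R)
        <= (f3 A)%:R.
Proof.
pose D := C + 1.
have D1 : 1 <= D by rewrite /D lerDr ltW.
have D0 : 0 < D by apply: lt_le_trans D1.
(* [2 ^ 20] collects [2 ^ 14], then 2 from [s2], 16 from [m2] and 2 from [nP]. *)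
exists (2 ^+ 20 * D ^+ 2)^-1.
  by rewrite invr_gt0 mulr_gt0 ?exprn_gt0.
move=> eps A /andP[eps0 eps1] energy.
set N := #|` A| in energy *.
(* For [N <= 1] the logarithm is 0 (with [ln 0 = 0]), and the left side vanishes. *)
have [N1|N2] := leqP N 1.
  have -> : log2 N%:R = 0 :> R.
    rewrite /log2; case: (N) N1 => [|[|//]] _; first by rewrite ln0 ?mul0r.
    by rewrite ln1 mul0r.
  by rewrite powR0 ?mul0r ?mulr0 ?ler0n //; apply/eqP; lra.
have N0 : 0 < N%:R :> R by rewrite ltr0n ltnW.
set l := log2 N%:R; have lE : 2 `^ l = N%:R :> R by exact: powR_log2.
have l1 : 1 <= l.
  rewrite /l /log2 ler_pdivlMr ?ln_gt0 ?ltr1n // mul1r ler_ln ?posrE //.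
  by rewrite ler_nat.
pose M := (1 + eps) * l; rewrite -/M; pose r := Num.sqrt M.
have M1 : 1 <= M by rewrite /M; nra.
have rM : r ^+ 2 = M by rewrite sqr_sqrtr // (le_trans _ M1).
have r1 : 1 <= r by rewrite -(@sqrtr1 R) ler_sqrt // (le_trans _ M1).
(* [n + M / n] is minimal at [n = r]; the integer taken satisfies [r < n <= r + 1]. *)
have [n' [rn nr]] := nat_above (le_trans ler01 r1).
have [n nE] : exists n, n = n'.+1 by exists n'.+1.
have n_gt0 : (0 < n)%N by rewrite nE.
have nr1 : n%:R <= r + 1 by rewrite nE -natr1 lerD2r.
have pow2n : n%:R <= 2 `^ r.
  apply: (@le_trans _ _ (2 `^ n'%:R)); last by rewrite ler_powR ?ler1n.
  by rewrite powR_mulrn // -natrX ler_nat nE ltn_expl.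
rewrite -nE in rn; clear n' nr nE.
have n0 : 0 < n%:R :> R by rewrite ltr0n.
(* [b ^ n = N ^ ((1 + eps) / 2)], which up to a constant bounds the number of progressions per
   element of [A]. *)
pose b : R := 2 `^ (M / (2 * n%:R)).
have pow2_ge1 (x : R) : 0 <= x -> 1 <= 2 `^ x.
  by move=> x0; rewrite -[leLHS](powRr0 (2 : R)) ler_powR // ler1n.
have b1 : 1 <= b by apply: pow2_ge1; apply: divr_ge0; lra.
have powX (x : R) k : (2 `^ x) ^+ k = 2 `^ (x * k%:R) :> R.
  by rewrite powRrM powR_mulrn // powR_ge0.
have pow2D (x y : R) : 2 `^ (x + y) = 2 `^ x * 2 `^ y :> R.
  by rewrite powRD // pnatr_eq0 implybT.
have bn : b ^+ n = 2 `^ (M / 2) by rewrite /b powX; congr (_ `^ _); field; lra.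
have b2 : b ^+ 2 = 2 `^ (M / n%:R) by rewrite /b powX; congr (_ `^ _); field; lra.
have b0 : 0 < b by apply: lt_le_trans b1.
have Db : 0 <= 2 * D * b by rewrite !mulr_ge0 ?ltW.
have [m [m_gt0 mge mle]] : exists m : nat,
    [/\ (0 < m)%N, 2 * D * b < m%:R & m%:R <= 2 * D * b + 1].
  by have [k [? ?]] := nat_above Db; exists k.+1; split=> //; rewrite -natr1 lerD2r.
set q : R := Num.sqrt n%:R.
have [s [sge sle]] : exists s : nat, q < s%:R /\ s%:R <= q + 1.
  have [k [? ?]] := nat_above (sqrtr_ge0 n%:R : 0 <= q).
  by exists k.+1; split=> //; rewrite -natr1 lerD2r.
have q2 : q ^+ 2 = n%:R by rewrite sqr_sqrtr.
have q1 : 1 <= q by rewrite -(@sqrtr1 R) ler_sqrt // ler1n.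
have ns : (n <= s ^ 2)%N.
  by rewrite -(ler_nat R) natrX -q2 lerXn2r ?nnegrE ?ltW //; lra.
have nm : (n <= m ^ 4)%N.
  rewrite -(ler_nat R) natrX; apply: (@le_trans _ _ (b ^+ 4)); last first.
    by rewrite lerXn2r ?nnegrE //; nra.
  apply: le_trans pow2n _; rewrite /b powX ler_powR ?ler1n //.
  have -> : M / (2 * n%:R) * 4%:R = 2 * M / n%:R by field; lra.
  by rewrite ler_pdivlMr // -rM; nra.
have pairs : (2 * ap3_pairs A <= m ^ n * N)%N.
  have : (ap3_pairs A)%:R <= D * 2 `^ (M / 2) * N%:R :> R.
    rewrite -(@ler_pXn2r _ 2) ?nnegrE ?mulr_ge0 ?powR_ge0 ?(ltW D0) //.
    have := ap3_pairs_energy A; rewrite -(ler_nat R) natrX natrM -/N => le1.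
    apply: le_trans le1 _.
    apply: le_trans (ler_wpM2l (ltW N0) energy) _.
    have -> : (D * 2 `^ (M / 2) * N%:R) ^+ 2 = N%:R * (D ^+ 2 * N%:R `^ (2 + eps)).
      rewrite !exprMn powX -lE -powRrM divfK ?pnatr_eq0 //.
      have -> : (2 `^ l) ^+ 2 = 2 `^ l * 2 `^ l :> R by rewrite expr2.
      have -> : l * (2 + eps) = l + M by rewrite /M; ring.
      by rewrite pow2D; ring.
    rewrite ler_wpM2l ?(ltW N0) // ler_wpM2r ?powR_ge0 //.
    by rewrite /D; nra.
  move=> Tle; rewrite -(ler_nat R) !natrM natrX.
  have mn : 2 * D * 2 `^ (M / 2) <= m%:R ^+ n.
    apply: (@le_trans _ _ ((2 * D * b) ^+ n)); last first.
      by rewrite lerXn2r ?nnegrE ?ler0n ?(ltW mge) // !mulr_ge0 //; lra.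
    rewrite exprMn bn ler_wpM2r ?powR_ge0 //.
    by rewrite ler_eXnr //; lra.
  apply: le_trans (ler_wpM2r (ltW N0) mn); lra.
set F : R := (f3 A)%:R.
have main : n%:R * N%:R <= 2 ^+ 14 * s%:R * m%:R ^+ 2 * (F * 2 ^+ n).
  by rewrite -!natrX -!natrM ler_nat; exact: f3_ge_of_ap3_pairs.
set P := 2 `^ (2 * r).
have P0 : 0 < P by exact: powR_gt0.
(* From [n <= r + 1] and [M / n <= r], the exponent is at most [2 * r + 1]. *)
have nP : 2 ^+ n * 2 `^ (M / n%:R) <= 2 * P.
  rewrite -powR_mulrn // -pow2D -[X in X * P]powRr1 // -pow2D ler_powR ?ler1n //.
  suff : M / n%:R <= r by lra.
  by rewrite ler_pdivrMr // -rM; nra.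
(* The factor [sqrt n] supplies the fourth root of the logarithm, since
   [l <= M = r ^ 2 <= n ^ 2]. *)
have lq : l `^ (1 / 4) <= q.
  apply: (@le_trans _ _ ((n%:R ^+ 2) `^ (1 / 4))).
    by rewrite ge0_ler_powR ?nnegrE //; [lra|lra|apply: sqr_ge0|rewrite /M in rM; nra].
  rewrite -powR_mulrn // -powRrM (_ : 2%:R * (1 / 4) = 2^-1 :> R); last by field.
  by rewrite powR12_sqrt.
have F0 : 0 <= F by exact: ler0n.
have m2 : m%:R ^+ 2 <= 16 * D ^+ 2 * 2 `^ (M / n%:R).
  rewrite -b2 (_ : 16 * _ * _ = (4 * D * b) ^+ 2); last by ring.
  by rewrite lerXn2r ?nnegrE //; nra.
have s2 : s%:R <= 2 * q by lra.
have {}main : q * N%:R <= 2 ^+ 20 * D ^+ 2 * (P * F).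
  rewrite -(ler_pM2l (lt_le_trans ltr01 q1)) [leLHS]mulrA -[q * q]expr2 q2.
  apply: le_trans main _.
  apply: (@le_trans _ _ (2 ^+ 14 * (2 * q) * (16 * D ^+ 2 * 2 `^ (M / n%:R)) *
    (F * 2 ^+ n))).
    rewrite ler_wpM2r ?mulr_ge0 ?exprn_ge0 // ler_pM ?mulr_ge0 ?exprn_ge0 //.
    by rewrite ler_wpM2l ?exprn_ge0.
  rewrite (_ : _ * (F * _) =
    q * (2 ^+ 19 * D ^+ 2 * (2 ^+ n * 2 `^ (M / n%:R) * F))); last by ring.
  rewrite ler_pM2l ?(lt_le_trans ltr01 q1) //.
  rewrite (_ : 2 ^+ 20 * _ * _ = 2 ^+ 19 * D ^+ 2 * (2 * P * F)); last by ring.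
  by rewrite ler_pM2l ?mulr_gt0 ?exprn_gt0 // ler_wpM2r.
have K0 : 0 < 2 ^+ 20 * D ^+ 2 by rewrite mulr_gt0 ?exprn_gt0.
rewrite ler_pdivrMl // mulrAC ler_pdivrMr // -mulrA [F * P]mulrC.
by apply: le_trans main; rewrite ler_wpM2r // ltW.
Qed.
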